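(* Assume Kriesell's conjecture for finite graphs, i.e. assume that for every positive integer $m$, every finite connected graph $H$ and every $2m$-edge-connected subset $R\subseteq V(H)$, the graph $H$ contains $m$ pairwise edge-disjoint $R$-Steiner trees. Let $k$ be a positive integer, let $G$ be a connected, finitely edge-separable, rayless graph and let $S\subseteq V(G)$ be a $2k$-edge-connected subset. Then $G$ contains $k$ pairwise edge-disjoint $S$-Steiner trees.
   Context: All graphs are simple (no loops, no multiple edges) and may be of any cardinality. A graph is rayless if it contains no one-way infinite path. A graph is finitely edge-separable if every pair of distinct vertices can be separated by a finite set of edges. A subset $S\subseteq V(G)$ is $m$-edge-connected (in $G$) if for every pair of vertices $u,v\in S$ there are $m$ pairwise edge-disjoint $u$–$v$ paths in $G$ (the paths may leave $S$). An $S$-Steiner tree of $G$ is a tree $T\subseteq G$ (a subgraph that is a tree, possibly infinite) with $S\subseteq V(T)$. *)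

(* Defs.v *)
From mathcomp Require Import all_boot.
From mathcomp Require Import boolp classical_sets cardinality.

Set Implicit Arguments.
Unset Strict Implicit.
Unset Printing Implicit Defensive.

Local Open Scope classical_set_scope.

(** A simple graph of arbitrary cardinality whose vertices are drawn from [V].
    Every type carries a classical [eqType] structure, so taking [V : eqType]
    is no restriction.  An undirected edge xy is represented by the two ordered
    pairs (x, y) and (y, x).  The vertex set is a field, rather than all of
    [V], so that subgraphs of a graph on [V] are again graphs on [V]. *)
Record graph (V : eqType) : Type := Graph {
  vertices : set V;
  edges : set (V * V);
  edges_sym : forall x y : V, edges (x, y) -> edges (y, x);
  edges_irrefl : forall x : V, ~ edges (x, x);
  edges_vertices : forall x y : V, edges (x, y) -> vertices x
}.

Definition adj (V : eqType) (G : graph V) : rel V :=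
  fun x y => (x, y) \in edges G.

Definition subgraph (V : eqType) (H G : graph V) : Prop :=
  vertices H `<=` vertices G /\ edges H `<=` edges G.

(** The path is the sequence [x :: p], in the convention of [path]. *)
Definition is_path (V : eqType) (G : graph V) (x y : V) (p : seq V) : Prop :=
  [/\ vertices G x, path (adj G) x p, last x p = y & uniq (x :: p)].

(** The edges traversed by [x :: p], in both orientations. *)
Definition path_edges (V : eqType) (x : V) (p : seq V) : set (V * V) :=
  [set e | e \in zip (belast x p) p \/ (e.2, e.1) \in zip (belast x p) p].

Definition is_connected (V : eqType) (G : graph V) : Prop :=
  vertices G !=set0 /\
  forall x y : V, vertices G x -> vertices G y -> exists p, is_path G x y p.

Definition acyclic (V : eqType) (G : graph V) : Prop :=
  forall c : seq V, (3 <= size c)%N -> ~ ucycle (adj G) c.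

Definition tree (V : eqType) (T : graph V) : Prop :=
  is_connected T /\ acyclic T.

Definition rayless (V : eqType) (G : graph V) : Prop :=
  ~ exists r : nat -> V, injective r /\ forall n : nat, adj G (r n) (r n.+1).

(** [F] may contain one or both orientations of an edge: [path_edges] is
    symmetric and finiteness is insensitive to this. *)
Definition edge_separates (V : eqType) (G : graph V) (F : set (V * V))
    (x y : V) : Prop :=
  forall p : seq V, is_path G x y p -> path_edges x p `&` F !=set0.

Definition finitely_edge_separable (V : eqType) (G : graph V) : Prop :=
  forall x y : V, vertices G x -> vertices G y -> x <> y ->
  exists F : set (V * V),
    [/\ finite_set F, F `<=` edges G & edge_separates G F x y].

Definition edge_connected_in (V : eqType) (G : graph V) (m : nat)
    (S : set V) : Prop :=
  forall u v : V, S u -> S v -> u <> v ->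
  exists P : 'I_m -> seq V,
    (forall i, is_path G u v (P i)) /\
    trivIset [set: 'I_m] (fun i => path_edges u (P i)).

Definition steiner_tree (V : eqType) (G : graph V) (S : set V)
    (T : graph V) : Prop :=
  [/\ subgraph T G, tree T & S `<=` vertices T].

(** The trees form an indexed family: if [S] has at most one vertex, edgeless
    trees may be repeated. *)
Definition has_disjoint_steiner_trees (V : eqType) (G : graph V) (k : nat)
    (S : set V) : Prop :=
  exists T : 'I_k -> graph V,
    (forall i, steiner_tree G S (T i)) /\
    trivIset [set: 'I_k] (fun i => edges (T i)).

Definition kriesell_conjecture : Prop :=
  forall (m : nat) (V : eqType) (H : graph V) (R : set V),
    (0 < m)%N ->
    finite_set (vertices H) ->
    is_connected H ->
    R `<=` vertices H ->
    edge_connected_in H (2 * m)%N R ->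
    has_disjoint_steiner_trees H m R.

(* Main.v *)
Require Import Defs.
From mathcomp Require Import all_boot.
From mathcomp Require Import boolp classical_sets cardinality.

Set Implicit Arguments.
Unset Strict Implicit.
Unset Printing Implicit Defensive.

Local Open Scope classical_set_scope.

(** The proof cuts [G] along its cutvertices.  Call two vertices unseparated if
    no third vertex separates them; the blocks of [G] are the maximal sets of
    pairwise unseparated vertices having at least two elements.  Two blocks
    share at most one vertex, hence no edge, and a path of [G] between two
    vertices of a block stays in the block.

    Blocks are finite ([block_finite]).  By a star-comb argument
    ([star_or_ray]), a connected rayless graph that contains an infinite set
    [X] has a vertex [u] that no finite set of other vertices cuts off from
    [X].  In an infinite block this gives first a vertex [v] with infinitely
    many neighbours, and then, in the block without [v], a vertex [u] that
    cannot be cut off from the neighbours of [v]; so no finite set of edges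
    separates [u] from [v].

    Kriesell's conjecture therefore applies inside every block.  Replace [S] by
    its gates, the vertices of the block [B] through which the vertices of [S]
    enter [B].  Of [2k] edge-disjoint paths of [G] between two vertices of [S]
    with distinct gates, each traverses [B] from one gate to the other, so the
    gates are [2k]-edge-connected in [B] ([gates_edge_connected]), and [B] has
    [k] edge-disjoint trees that contain all of its gates.

    For each [i < k], let [U i] be the union of the [i]-th trees of all blocks.
    The [U i] are edge-disjoint, since blocks are.  They link up [S]: between
    two vertices [s] and [t] of [S] lie the vertices that separate [s] from
    [t]; each of them is a gate in every block that contains it, and consecutive
    ones share a block ([conn_essential]).  A breadth-first spanning tree of the
    component of [U i] that contains [S] is the [i]-th tree. *)

(** * Walks along a relation *)

(** Connectedness is taken along an arbitrary relation rather than in a graph,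
    so that deleting vertices or edges and restricting to the edges of a given
    path are all changes of [e]. *)
Definition conn (V : eqType) (e : rel V) (x y : V) : Prop :=
  exists2 p, path e x p & last x p = y.

Section Conn.
Variable V : eqType.
Implicit Types (e : rel V) (x y z : V).

Lemma conn_refl e x : conn e x x.
Proof. by exists [::]. Qed.

Lemma conn1 e x y : e x y -> conn e x y.
Proof. by move=> exy; exists [:: y] => //=; rewrite exy. Qed.

Lemma conn_trans e y x z : conn e x y -> conn e y z -> conn e x z.
Proof.
move=> [p pP <-] [q qP <-]; exists (p ++ q); last by rewrite last_cat.
by rewrite cat_path pP.
Qed.

Lemma conn_sym e : symmetric e -> forall x y, conn e x y -> conn e y x.
Proof.
move=> e_sym x y [p pP <-]; exists (rev (belast x p)).
  by rewrite rev_path (eq_path (e' := e)).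
by case: p {pP} => //= z p; rewrite rev_cons last_rcons.
Qed.

Lemma conn_ind e y (P : V -> Prop) :
    P y -> (forall x z, e x z -> conn e z y -> P z -> P x) ->
  forall x, conn e x y -> P x.
Proof.
move=> Py step x [p]; elim: p x => [x _ /= -> //|z p IHp x /= /andP[exz pP] py].
by apply: (step x z exz); [exists p | apply: IHp].
Qed.

Lemma conn_mono e e' x y : subrel e e' -> conn e x y -> conn e' x y.
Proof. by move=> sub_e [p pP <-]; exists p => //; apply: sub_path pP. Qed.

Lemma conn_uniq e x y : conn e x y ->
  exists p, [/\ path e x p, last x p = y & uniq (x :: p)].
Proof. by move=> [p /shortenP[q qP q_uniq _] <-]; exists q. Qed.

Lemma path_edges_rel e x p a b : path e x p -> path_edges x p (a, b) ->
  e a b \/ e b a.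
Proof.
have zip_rel d : path e x p -> d \in zip (belast x p) p -> e d.1 d.2.
  elim: p x => //= z p IHp x /andP[exz pP].
  by rewrite inE => /predU1P[-> //|]; apply: IHp.
by move=> pP [/(zip_rel _ pP)|/(zip_rel _ pP)]; [left|right].
Qed.

(** The traversed edges as a relation: a walk along [path_rel x p] is one that
    uses only edges of the path. *)
Definition path_rel x (p : seq V) : rel V :=
  [rel a b | `[< path_edges x p (a, b) >]].

Lemma path_rel_sym x p : symmetric (path_rel x p).
Proof. by move=> a b; apply/asboolP/asboolP => -[] /=; [right|left|right|left]. Qed.

Lemma path_path_rel x p : path (path_rel x p) x p.
Proof.
elim: p x => //= z p IHp x; apply/andP; split.
  by apply/asboolP; left; rewrite inE eqxx.
apply: sub_path (IHp z) => a b /asboolP ab; apply/asboolP.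
by case: ab => /= ab; [left|right]; rewrite /= inE ab orbT.
Qed.

End Conn.

(** * Walks inside a set of vertices *)

Section Graph.
Variables (V : eqType) (G : graph V).
Implicit Types (A B S F : set V) (x y z c : V).

Lemma adjP x y : adj G x y <-> edges G (x, y).
Proof. by split=> [/set_mem|/mem_set]. Qed.

Lemma adj_sym : symmetric (adj G).
Proof. by move=> x y; apply/idP/idP => /adjP/edges_sym/adjP. Qed.

Lemma path_vertices x p : vertices G x -> path (adj G) x p ->
  vertices G (last x p).
Proof.
elim: p x => //= y p IHp x _ /andP[/adjP/edges_sym/edges_vertices Gy].
exact: IHp.
Qed.

Lemma conn_is_path e x y : vertices G x -> subrel e (adj G) -> conn e x y ->
  exists2 p, is_path G x y p & path e x p.
Proof.
move=> Gx eG /conn_uniq[p [pP py p_uniq]]; exists p => //.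
by split=> //; apply: sub_path pP.
Qed.

(** A walk of length 0 along [within A] is allowed to sit outside [A]; this
    keeps [conn (within A)] reflexive, and any longer walk lies in [A]. *)
Definition within A : rel V := [rel x y | [&& adj G x y, x \in A & y \in A]].

Lemma withinP A x y : within A x y <-> [/\ adj G x y, A x & A y].
Proof.
split=> [/and3P[xy /set_mem Ax /set_mem Ay] //|[xy Ax Ay]].
by apply/and3P; split=> //; apply: mem_set.
Qed.

Lemma within_adj A : subrel (within A) (adj G).
Proof. by move=> x y /withinP[]. Qed.

Lemma within_sym A : symmetric (within A).
Proof.
by move=> x y; apply/idP/idP => /withinP[xy Ax Ay]; apply/withinP;
  split=> //; rewrite adj_sym.
Qed.

Lemma conn_within_sym A x y : conn (within A) x y -> conn (within A) y x.
Proof. exact/conn_sym/within_sym. Qed.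

Lemma conn_within_sub A A' x y : A `<=` A' ->
  conn (within A) x y -> conn (within A') x y.
Proof.
move=> sAA'; apply: conn_mono => a b /withinP[ab Aa Ab].
by apply/withinP; split=> //; apply: sAA'.
Qed.

Lemma conn_within_l A x y : conn (within A) x y -> x <> y -> A x.
Proof. by move=> [[|z p] /=]; [move=> _ -> | case/andP=> /withinP[]]. Qed.

Lemma path_within A x p : path (within A) x p -> A x ->
  forall z, z \in x :: p -> A z.
Proof.
elim: p x => [x _ Ax z|y p IHp x /= /andP[/withinP[_ _ Ay] pP] Ax z].
  by rewrite inE => /eqP->.
by rewrite inE => /predU1P[->//|]; apply: IHp.
Qed.

Lemma path_withinI A x p : path (adj G) x p ->
  (forall z, z \in x :: p -> A z) -> path (within A) x p.
Proof.
elim: p x => //= y p IHp x /andP[xy pP] pA; rewrite IHp // ?andbT.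
  by apply/withinP; split=> //; apply: pA; rewrite !inE eqxx ?orbT.
by move=> z zp; apply: pA; rewrite inE zp orbT.
Qed.

(** * Blocks *)

Definition unseparated x y :=
  forall c, c <> x -> c <> y -> conn (within (~` [set c])) x y.

Lemma unseparated_refl x : unseparated x x.
Proof. by move=> c _ _; apply: conn_refl. Qed.

Lemma unseparated_sym x y : unseparated x y -> unseparated y x.
Proof. by move=> xy c cy cx; apply/conn_within_sym/xy. Qed.

Lemma adj_unseparated x y : adj G x y -> unseparated x y.
Proof. by move=> xy c cx cy; apply/conn1/withinP; split=> //; apply/nesym. Qed.

(** Maximality asks [z] to be unseparated from two distinct elements of [B] only:
    any vertex differs from one of the two, which it then separates neither from
    [z] nor from the rest of [B], so [z] is unseparated from all of [B]. *)
Record block B : Prop := Block {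
  block_sub : B `<=` vertices G;
  block_unseparated : forall x y, B x -> B y -> unseparated x y;
  block_pair : exists x y, [/\ B x, B y & x <> y];
  block_max : forall x y z, B x -> B y -> x <> y -> vertices G z ->
    unseparated x z -> unseparated y z -> B z }.

(** The block through [x] and [y] consists of the vertices unseparated from both
    of them: a third vertex [c] differs from [x] or from [y], so any two such
    vertices are joined in [G - c] through [x] or through [y]. *)
Lemma block_exists x y : vertices G x -> vertices G y -> x <> y ->
  unseparated x y -> exists2 B, block B & B x /\ B y.
Proof.
move=> Gx Gy xNy xy.
pose B := [set z | [/\ vertices G z, unseparated x z & unseparated y z]].
have Bx : B x by split=> //; [apply: unseparated_refl|apply: unseparated_sym].
have By : B y by split=> //; apply: unseparated_refl.
have Bsep z w : B z -> B w -> unseparated z w.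
  move=> [_ xz yz] [_ xw yw] c cz cw.
  have [cx|/eqP cx] := eqVneq c x.
    have cy : c <> y by rewrite cx.
    by apply: conn_trans (yw c cy cw); apply/conn_within_sym/yz.
  by apply: conn_trans (xw c cx cw); apply/conn_within_sym/xz.
exists B; split=> //; first by move=> z [].
  by exists x, y.
move=> a b z Ba Bb aNb Gz az bz.
have close w : B w -> unseparated w z.
  move=> Bw c cw cz.
  have [ca|/eqP ca] := eqVneq c a.
    have cb : c <> b by rewrite ca.
    by apply: conn_trans (bz c cb cz); apply: Bsep.
  by apply: conn_trans (az c ca cz); apply: Bsep.
by split=> //; apply: close.
Qed.

Lemma block_eq B B' x y : block B -> block B' -> x <> y ->
  B x -> B y -> B' x -> B' y -> B = B'.
Proof.
move=> bB bB' xNy Bx By B'x B'y; apply/seteqP; split=> z Bz.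
  apply: (block_max bB' B'x B'y) => //; first exact: (block_sub bB).
    exact: (block_unseparated bB).
  exact: (block_unseparated bB).
apply: (block_max bB Bx By) => //; first exact: (block_sub bB').
  exact: (block_unseparated bB').
exact: (block_unseparated bB').
Qed.

(** A path that leaves [B] at [c] cannot come back to [B] elsewhere: its first
    vertex [z] after [c] is joined to [c] by an edge and to [c'] without [c], so
    no vertex separates it from both. *)
Lemma block_attach B z c c' : block B -> B c -> B c' -> adj G z c ->
  c <> c' -> conn (within (~` [set c])) z c' -> B z.
Proof.
move=> bB Bc Bc' zc cNc' zc'.
apply: (block_max bB Bc Bc' cNc').
- exact/edges_vertices/adjP/zc.
- by apply: adj_unseparated; rewrite adj_sym.
move=> d dc' dz; have [->|/eqP dc] := eqVneq d c; first exact: conn_within_sym.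
apply: conn_trans (block_unseparated bB Bc' Bc dc' dc) _.
by apply/conn1/withinP; split; [rewrite adj_sym|apply/nesym|apply/nesym].
Qed.

Lemma block_path B x p : block B -> B x -> B (last x p) ->
  path (adj G) x p -> uniq (x :: p) -> forall z, z \in x :: p -> B z.
Proof.
move=> bB; elim: p x => [x Bx _ _ _ z|y p IHp x Bx Bl].
  by rewrite inE => /eqP->.
rewrite [path _ _ _]/= => /andP[xy pP] /andP[xNp p_uniq].
suff By : B y.
  by move=> z; rewrite inE => /predU1P[->//|]; apply: IHp.
apply: (block_attach bB Bx Bl); first by rewrite adj_sym.
  by move=> xl; move: xNp; rewrite {1}xl /= mem_last.
exists p => //; apply: path_withinI => // z zp /= zx.
by move: xNp; rewrite -zx zp.
Qed.

Lemma block_conn_avoid B F x y : block B -> B x -> B y ->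
  conn (within F) x y -> conn (within (B `&` F)) x y.
Proof.
move=> bB Bx By /conn_uniq[p [pP py p_uniq]]; exists p => //.
have pG : path (adj G) x p by apply: sub_path pP; apply: within_adj.
have pB : path (within B) x p.
  apply: path_withinI => //; apply: (block_path bB) => //.
  by rewrite py.
elim: p x pP pB {Bx py p_uniq pG} => //= z p IHp x /andP[xz pP] /andP[xz' pB].
rewrite IHp // andbT; move/withinP: xz => [xz Fx Fz].
by move/withinP: xz' => [_ Bx Bz]; apply/withinP.
Qed.

(** * Gates *)

(** [c] is the vertex at which walks from [s] first meet [B]. *)
Definition gate B s c := B c /\ conn (within [set z | B z -> z = c]) s c.

Lemma gate_in B z c : gate B z c -> B z -> z = c.
Proof.
move=> [Bc zc] Bz; apply: contrapT => zNc.
exact/zNc/(conn_within_l zc zNc).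
Qed.

Lemma gate_refl B c : B c -> gate B c c.
Proof. by move=> Bc; split=> //; apply: conn_refl. Qed.

Lemma gate_step B z z' c : adj G z z' -> ~ B z -> gate B z' c -> gate B z c.
Proof.
move=> zz' nBz gz; have [Bc z'c] := gz; split=> //.
apply: conn_trans z'c; apply/conn1/withinP; split=> //.
exact: gate_in gz.
Qed.

Lemma gate_exists B s b : B b -> conn (adj G) s b -> exists c, gate B s c.
Proof.
move=> Bb; move: s; apply: conn_ind => [|s z sz _ [c zc]].
  by exists b; apply: gate_refl.
have [Bs|nBs] := pselect (B s); first by exists s; apply: gate_refl.
by exists c; apply: gate_step zc.
Qed.

(** Two different gates [c] and [c'] of [s] would be joined, via [s], by a path
    whose interior avoids [B], whereas paths between vertices of a block stay in
    it; and neither of the two walks can use the edge from [c] to [c']. *)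
Lemma gate_inj B s c c' : block B -> gate B s c -> gate B s c' -> c = c'.
Proof.
move=> bB [Bc sc] [Bc' sc']; apply: contrapT => cNc'.
pose A a := [set z | B z -> z = a].
pose e := [rel x y | within (A c) x y || within (A c') x y].
have /conn_uniq[[|z p] [pP pc' p_uniq]] : conn e c c'.
    apply: (@conn_trans _ _ s).
      by apply: conn_mono (conn_within_sym sc) => x y /= ->.
    by apply: conn_mono sc' => x y /= ->; rewrite orbT.
  exact: cNc'.
have eG : subrel e (adj G) by move=> x y /= /orP[]; apply: within_adj.
have Bz : B z.
  apply: (block_path bB Bc _ (sub_path eG pP) p_uniq); first by rewrite pc'.
  by rewrite !inE eqxx orbT.
move: pP p_uniq => /= /andP[/orP[]/withinP[_ /(_ Bc) cA /(_ Bz) zA] _].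
  by rewrite -zA inE eqxx.
by move=> _; apply: cNc'.
Qed.

(** Follow the gates of the vertices of a walk from [s] to [t].  The gate changes
    only along an edge with both ends in [B], and there the two gates are the
    ends of that edge; so the walk contains one from [u] to [v]. *)
Lemma conn_gates B e s t u v : block B -> subrel e (adj G) -> conn e s t ->
  gate B s u -> gate B t v -> conn e u v.
Proof.
move=> bB eG st su tv; move: u su; move: s st.
apply: conn_ind => [u tu|s z sz zt IHs u su].
  by rewrite (gate_inj bB tu tv); apply: conn_refl.
have [c zc] : exists c, gate B z c.
  apply: (@gate_exists B z v); first by case: tv.
  apply: (@conn_trans _ _ t); first exact: conn_mono zt.
  by case: tv => _; apply: conn_mono; apply: within_adj.
have cv := IHs c zc.
have [Bs|nBs] := pselect (B s); last first.
  by rewrite (gate_inj bB su (gate_step (eG _ _ sz) nBs zc)).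
have [Bz|nBz] := pselect (B z); last first.
  have zs : adj G z s by rewrite adj_sym; apply: eG.
  by rewrite (gate_inj bB zc (gate_step zs nBz su)) in cv.
rewrite -(gate_in su Bs); apply: conn_trans cv.
by rewrite -(gate_in zc Bz); apply: conn1.
Qed.

Definition gates B S : set V := [set c | exists2 s, S s & gate B s c].

Definition induced_edges B : set (V * V) :=
  [set e | [/\ edges G e, B e.1 & B e.2]].

Lemma induced_sym B x y : induced_edges B (x, y) -> induced_edges B (y, x).
Proof. by move=> [/edges_sym]. Qed.

Lemma induced_irrefl B x : ~ induced_edges B (x, x).
Proof. by move=> [/edges_irrefl]. Qed.

Lemma induced_vertices B x y : induced_edges B (x, y) -> B x.
Proof. by case. Qed.

Definition induced B : graph V :=
  Graph (@induced_sym B) (@induced_irrefl B) (@induced_vertices B).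

Lemma adj_induced B x y : within B x y -> adj (induced B) x y.
Proof. by move=> /withinP[/adjP xy Bx By]; apply/mem_set. Qed.

Lemma induced_block_connected B : block B -> is_connected G ->
  is_connected (induced B).
Proof.
move=> bB [_ Gconn]; split.
  by have [x [_ [Bx _ _]]] := block_pair bB; exists x.
move=> x y Bx By.
have [p [_ pP py p_uniq]] := Gconn x y (block_sub bB Bx) (block_sub bB By).
exists p; split=> //; apply: sub_path (@adj_induced B) _ _ _.
by apply: path_withinI => //; apply: (block_path bB); rewrite ?py.
Qed.

(** Each path between two vertices of [S] yields, by [conn_gates], a path in [B]
    between their gates that uses only its edges; so disjointness is kept. *)
Lemma gates_edge_connected B S m : block B ->
  edge_connected_in G m S -> edge_connected_in (induced B) m (gates B S).
Proof.
move=> bB Sconn u v [s Ss su] [t St tv] uNv.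
have sNt : s <> t.
  by move=> st; apply: uNv; rewrite st in su; apply: gate_inj su tv.
have [P [PP Pdisj]] := Sconn s t Ss St sNt.
have /choice[Q QP] : forall i, exists q,
    is_path (induced B) u v q /\ path_edges u q `<=` path_edges s (P i).
  move=> i; have [_ pP pt _] := PP i.
  have eG : subrel (path_rel s (P i)) (adj G).
    move=> a b /asboolP/(path_edges_rel pP) [//|]; by rewrite adj_sym.
  have st : conn (path_rel s (P i)) s t.
    by exists (P i) => //; apply: path_path_rel.
  have /conn_uniq[q [qP qv q_uniq]] := conn_gates bB eG st su tv.
  have [[Bu _] [Bv _]] := (su, tv).
  exists q; split.
    split=> //; apply: sub_path (@adj_induced B) _ _ _.
    have qG : path (adj G) u q by apply: sub_path qP.
    by apply: path_withinI => //; apply: (block_path bB); rewrite ?qv.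
  move=> [a b] /(path_edges_rel qP)[/asboolP //|].
  by rewrite path_rel_sym => /asboolP.
exists Q; split=> [i|]; first by case: (QP i).
move=> i j _ _ [e [/(QP i).2 ei /(QP j).2 ej]].
by apply: Pdisj => //; exists e.
Qed.

End Graph.

(** * Blocks are finite *)

Section Finiteness.
Variables (V : eqType) (G : graph V).
Implicit Types (A B S F X : set V) (x y z c : V).

(** Grow a path from [r], keeping infinitely many elements of [X] reachable from
    its end without meeting the rest of the path.  As there is no ray, this
    stops at some end [u]: from each neighbour of [u] off the path only finitely
    many elements of [X] are reachable when [u] is deleted as well.  Deleting a
    finite set [F] then affects only the finitely many components met by [F],
    and these contain only finitely many elements of [X]. *)
Lemma star_or_ray A X r : rayless G ->
  infinite_set (X `&` conn (within G A) r) ->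
  exists2 u, A u & forall F, finite_set F -> ~ F u ->
    infinite_set (X `&` conn (within G (A `\` F)) u).
Proof.
move=> noray Xr.
pose reach (p : seq V) u := X `&` conn (within G (A `\` [set` p])) u.
(* a state is the end of the path and the list of its earlier vertices *)
pose good (a : V * seq V) := a.1 \notin a.2 /\ infinite_set (reach a.2 a.1).
have good0 : good (r, [::]).
  split=> //; rewrite /reach /=; suff -> : A `\` [set` [::]] = A by [].
  by apply/seteqP; split=> [z []|z Az] //; split.
have [next|] := pselect (forall a, good a -> exists w,
    adj G a.1 w /\ good (w, a.1 :: a.2)).
  have /choice[f fP] : forall a, exists w, good a ->
      adj G a.1 w /\ good (w, a.1 :: a.2).
    move=> a; have [/next[w wP]|nga] := pselect (good a); last by exists a.1.
    by exists w.
  pose st n := iter n (fun a => (f a, a.1 :: a.2)) (r, [::]).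
  have st_good n : good (st n) by elim: n => //= n /fP[].
  case: noray; exists (fun n => (st n).1); split; last first.
    by move=> n; case: (fP _ (st_good n)).
  have st_mem m n : (m < n)%N -> (st m).1 \in (st n).2.
    elim: n => // n IHn; rewrite ltnS leq_eqVlt => /predU1P[->|/IHn mn] /=.
      by rewrite inE eqxx.
    by rewrite inE mn orbT.
  have st_neq m n : (m < n)%N -> (st m).1 <> (st n).1.
    by move=> /st_mem + mn; rewrite mn => nn; have [/negP] := st_good n.
  by move=> m n mn; case: (ltngtP m n) => // /st_neq; rewrite mn.
move=> /existsNP[[u p] /not_implyP[[/= uNp Iu] /forallNP stuck]].
exists u.
  have [x [[_ ux] xNu]] : (reach p u `\` [set u]) !=set0.
    by apply: infinite_setN0; apply: infinite_setD.
  by have [] := conn_within_l ux (nesym xNu).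
move=> F Ffin nFu Zfin; apply: Iu.
set Z := X `&` _ in Zfin.
(* the elements of F that lie in a component next to u *)
pose F' := F `&` [set w | finite_set (reach (u :: p) w)].
pose lost := \bigcup_(w in F') reach (u :: p) w.
apply: (@sub_finite_set _ _ ([set u] `|` Z `|` lost)).
  move=> x [Xx /conn_uniq[[|w q] [ /= qP qx q_uniq]]]; first by left; left.
  have [Zx|nZx] := pselect (Z x); first by left; right.
  right; move: qP => /andP[/withinP[uw [Au _] [Aw wNp]] qP].
  move: q_uniq => /andP[uNq q_uniq].
  have inA z : z \in w :: q -> (A `\` [set` p]) z by apply: (path_within qP).
  have qP' : path (within G (A `\` [set` u :: p])) w q.
    apply: path_withinI; first exact: sub_path (@within_adj _ _ _) _ _ qP.
    move=> z zq; have [Az zNp] := inA z zq; split=> //= zup.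
    move: zup; rewrite inE => /predU1P[zu|//].
    by move: uNq; rewrite -zu zq.
  have [d dq Fd] : exists2 d, d \in w :: q & F d.
    apply: contrapT => nF; apply: nZx; split=> //.
    exists (w :: q) => //; apply: path_withinI.
      by rewrite /= uw; apply: sub_path (@within_adj _ _ _) _ _ qP.
    move=> z; rewrite inE => /predU1P[->//|zq].
    split; first by case: (inA z zq).
    by move=> Fz; apply: nF; exists z.
  have wd : conn (within G (A `\` [set` u :: p])) w d.
    case/splitPl: dq qP' => q1 q2 q1d; rewrite cat_path => /andP[q1P _].
    by exists q1.
  have wx : conn (within G (A `\` [set` u :: p])) w x by exists q.
  have dx := conn_trans (conn_within_sym wd) wx.
  exists d => //; split=> //=.
  have reach_w : finite_set (reach (u :: p) w).
    apply: contrapT => wI; apply: (stuck w); split=> //=; split=> //=.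
    rewrite inE negb_or; apply/andP; split; last exact/negP.
    by apply: contra uNq => /eqP <-; rewrite inE eqxx.
  apply: sub_finite_set reach_w => y [Xy dy]; split=> //.
  exact: conn_trans wd dy.
rewrite !finite_setU; split; first by split; first exact: finite_set1.
apply: bigcup_finite; last by move=> w [].
by apply: sub_finite_set Ffin => w [].
Qed.

Lemma separable_conn u v : finitely_edge_separable G ->
  vertices G u -> vertices G v -> u <> v ->
  exists2 F : set (V * V), finite_set F &
    ~ conn [rel a b | [&& adj G a b, (a, b) \notin F & (b, a) \notin F]] u v.
Proof.
move=> Gsep Gu Gv uNv; have [F [Ffin _ Fsep]] := Gsep u v Gu Gv uNv.
exists F => //; set e := (X in conn X).
have eG : subrel e (adj G) by move=> a b /and3P[].
move=> /(conn_is_path Gu eG)[p /Fsep[[a b] [/path_edges_rel ab /mem_set Fab]] pP].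
by case/ab: pP => /and3P[_]; rewrite Fab.
Qed.

(** [star_or_ray] is used twice: for all of [B], where it gives a vertex [v] with
    infinitely many neighbours in [B], as otherwise these would form a finite
    set cutting off [v]; and for the neighbours of [v] in [B] minus [v], which
    is connected.  The vertex [u] so obtained has infinitely many paths of the
    form [u ... x v], and deleting finitely many edges leaves one of them. *)
Lemma block_finite B : finitely_edge_separable G -> rayless G ->
  block G B -> is_connected G -> finite_set B.
Proof.
move=> Gsep Gray bB [_ Gconn]; apply: contrapT => Binf.
have Bconn x y : B x -> B y -> conn (within G B) x y.
  move=> Bx By; have -> : B = B `&` setT by rewrite setIT.
  apply: (block_conn_avoid bB) => //.
  have [p [_ pP py _]] := Gconn x y (block_sub bB Bx) (block_sub bB By).
  by exists p => //; apply: path_withinI.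
have [r Br] := infinite_setN0 Binf.
have Binf_r : infinite_set (B `&` conn (within G B) r).
  apply: contra_not Binf; apply: sub_finite_set => x Bx; split=> //.
  exact: Bconn.
have [v Bv v_star] := star_or_ray Gray Binf_r.
pose N := B `&` [set w | adj G v w].
have Ninf : infinite_set N.
  move=> Nfin; have nNv : ~ N v by move=> [_ /adjP/edges_irrefl].
  have [x [[_ vx] xNv]] :
      ((B `&` conn (within G (B `\` N)) v) `\` [set v]) !=set0.
    by apply: infinite_setN0; apply: infinite_setD => //; apply: v_star.
  case: vx => -[/= _ vx|w q /= /andP[/withinP[vw _ [Bw nNw]] _] _].
    by apply: xNv.
  by apply: nNw.
have [r' [Br' vr']] := infinite_setN0 Ninf.
have neq_v w : adj G v w -> v <> w.
  by move=> /adjP + vw; rewrite vw => /edges_irrefl.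
have Ninf_r' : infinite_set (N `&` conn (within G (B `&` ~` [set v])) r').
  apply: contra_not Ninf; apply: sub_finite_set => x [Bx vx]; split=> //.
  apply: (block_conn_avoid bB) => //.
  by apply: (block_unseparated bB) => //; apply: neq_v.
have [u [Bu uNv] u_star] := star_or_ray Gray Ninf_r'.
have [F Ffin Fsep] :=
  separable_conn Gsep (block_sub bB Bu) (block_sub bB Bv) uNv.
(* an edge with an end that is neither u nor in F' does not belong to F *)
pose F' := ((fst @` F) `|` (snd @` F)) `\` [set u].
have F'fin : finite_set F'.
  by apply: finite_setD; rewrite finite_setU; split; apply: finite_image.
have nF'u : ~ F' u by move=> [_]; apply.
have F'P a b : a <> u -> ~ F' a -> (a, b) \notin F /\ (b, a) \notin F.
  move=> aNu nF'a; split; apply/negP => /set_mem Fab; apply: nF'a; split=> //.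
    by left; exists (a, b).
  by right; exists (b, a).
set A := B `&` _ in u_star.
have [x [[[Bx vx] ux] xNu]] :
    ((N `&` conn (within G (A `\` F')) u) `\` [set u]) !=set0.
  by apply: infinite_setN0; apply: infinite_setD => //; apply: u_star.
apply: Fsep; apply: (@conn_trans _ _ x).
  apply: conn_mono ux => a b /withinP[ab [_ nFa] [_ nFb]]; apply/and3P.
  have [au|/eqP aNu] := eqVneq a u; last by have [] := F'P a b aNu nFa.
  have bNu : b <> u by move=> bu; move: ab; rewrite au bu => /adjP/edges_irrefl.
  by have [] := F'P b a bNu nFb.
have [_ nF'x] := conn_within_l (conn_within_sym ux) xNu.
by apply: conn1; rewrite /= adj_sym vx; have [-> ->] := F'P x v xNu nF'x.
Qed.

End Finiteness.

(** * Breadth-first spanning trees *)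

Section SpanningTree.
Variable V : eqType.

Lemma seq_argmax (d : V -> nat) (s : seq V) : s <> [::] ->
  exists2 x, x \in s & forall y, y \in s -> (d y <= d x)%N.
Proof.
elim: s => // a s IHs _; have [->|/eqP/IHs[x xs xmax]] := eqVneq s [::].
  by exists a; rewrite ?inE // => y; rewrite inE => /eqP->.
have [ax|/ltnW xa] := leqP (d a) (d x).
  by exists x; rewrite ?inE ?xs ?orbT // => y; rewrite inE => /predU1P[->|/xmax].
exists a; first by rewrite inE eqxx.
by move=> y; rewrite inE => /predU1P[->//|/xmax/leq_trans]; apply.
Qed.

(** [d] is the distance from [s], and [f x] the last vertex before [x] on a
    shortest walk from [s] to [x]. *)
Lemma bfs_parent (e : rel V) s : exists (d : V -> nat) (f : V -> V),
  forall x, conn e s x -> x <> s ->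
  [/\ conn e s (f x), e (f x) x & d x = (d (f x)).+1].
Proof.
pose lvl n x := exists p, [/\ path e s p, last s p = x & size p = n].
have /choice[d dP] : forall x, exists n, conn e s x ->
    lvl n x /\ forall m, lvl m x -> (n <= m)%N.
  move=> x; have [[p pP px]|nx] := pselect (conn e s x); last by exists 0%N.
  have ex : exists n, `[< lvl n x >] by exists (size p); apply/asboolP; exists p.
  exists (ex_minn ex) => _; case: ex_minnP => n /asboolP nx nmin.
  by split=> // m mx; apply/nmin/asboolP.
exists d.
suff /choice[f fP] : forall x, exists y, conn e s x -> x <> s ->
    [/\ conn e s y, e y x & d x = (d y).+1] by exists f.
move=> x; have [sx|nsx] := pselect (conn e s x); last by exists x.
have [xs|xNs] := pselect (x = s); first by exists x.
have [[p [pP px pn]] dmin] := dP x sx.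
case: (lastP p) pP px pn => [/= _ /esym//|q z].
rewrite rcons_path last_rcons size_rcons => /andP[qP qz] zx qn; subst z.
have sy : conn e s (last s q) by exists q.
have [[p' [p'P p'y p'n]] dmin'] := dP _ sy.
exists (last s q); split=> //; apply/eqP; rewrite eqn_leq; apply/andP; split.
  apply: dmin; exists (rcons p' x).
  by rewrite rcons_path last_rcons size_rcons p'P p'y p'n.
by rewrite -qn ltnS; apply: dmin'; exists q.
Qed.

(** Join each vertex other than [s] to its parent.  There is no cycle, since both
    neighbours on it of a vertex farthest from [s] would be its parent. *)
Lemma spanning_tree (e : rel V) (G : graph V) s :
  symmetric e -> subrel e (adj G) -> vertices G s ->
  exists T : graph V, [/\ subgraph T G, tree T, conn e s `<=` vertices T &
    forall x y, edges T (x, y) -> e x y].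
Proof.
move=> e_sym eG Gs; have [d [f fP]] := bfs_parent e s.
pose child x y := [/\ conn e s x, x <> s & y = f x].
pose E := [set a : V * V | child a.1 a.2 \/ child a.2 a.1].
have E_e x y : E (x, y) -> e x y.
  by case=> /= -[sx xNs ->]; have [_ ? _] := fP _ sx xNs; rewrite // e_sym.
have E_sym x y : E (x, y) -> E (y, x) by case; [right|left].
have E_irrefl x : ~ E (x, x).
  by case=> /= -[sx xNs xf]; have [_ _] := fP _ sx xNs; rewrite -xf => /n_Sn.
have E_vert x y : E (x, y) -> conn e s x.
  by case=> /= -[sx xNs] // ->; have [] := fP _ sx xNs.
pose T := Graph E_sym E_irrefl E_vert.
have T_root x : conn e s x -> conn (adj T) x s.
  have [n] := ubnP (d x); elim: n x => // n IHn x dx sx.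
  have [->|/eqP xNs] := eqVneq x s; first exact: conn_refl.
  have [sf _ df] := fP x sx xNs.
  apply: (@conn_trans _ _ (f x)); last by apply: IHn => //; rewrite -df.
  by apply/conn1/adjP; left.
exists T; split=> //.
- split=> /= [x [p pP <-]|[x y] /E_e/eG/adjP //].
  by apply: path_vertices; rewrite // (sub_path eG).
- split.
    split; first by exists s; apply: conn_refl.
    move=> x y sx sy; have sub_T : subrel (adj T) (adj T) by [].
    have xy : conn (adj T) x y.
      exact: (conn_trans (T_root x sx) (conn_sym (@adj_sym _ T) (T_root y sy))).
    by have [p pP _] := conn_is_path (G := T) sx sub_T xy; exists p.
  move=> c c3 /andP[c_cyc c_uniq].
  have [x xc xmax] : exists2 x, x \in c & forall y, y \in c -> (d y <= d x)%N.
    by apply: seq_argmax => c0; rewrite c0 in c3.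
  have child_max y : y \in c -> adj T x y -> y = f x.
    move=> /xmax yx /adjP[[] //|] /= [sy yNs xf].
    by have [_ _ dy] := fP y sy yNs; rewrite dy -xf ltnn in yx.
  have [i c' c'E] := rot_to xc.
  have c_mem y : y \in x :: c' -> y \in c by rewrite -c'E mem_rot.
  move: c_cyc c_uniq c3; rewrite -(rot_cycle i) -(rot_uniq i) -(size_rot i) c'E.
  case: c' c'E c_mem => [//|y c'] _ c_mem; case/lastP: c' c_mem => [//|c' z] c_mem.
  rewrite [cycle _ _]/= rcons_path last_rcons => /and3P[xy _ zx].
  have -> : y = f x by apply: child_max => //; apply: c_mem; rewrite !inE eqxx orbT.
  have -> : z = f x.
    apply: child_max; last by rewrite adj_sym.
    by apply: c_mem; rewrite !inE mem_rcons inE eqxx !orbT.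
  by move=> /and3P[_ /negP[]]; rewrite mem_rcons inE eqxx.
Qed.

End SpanningTree.

(** * Linking the vertices of [S] through the blocks *)

Section Linking.
Variables (V : eqType) (G : graph V) (S : set V).

Definition essential (s t x : V) : Prop :=
  [\/ x = s, x = t | ~ conn (within G (~` [set x])) s t].

(** If [x] separates [s] from [t], it is the gate of [s] or of [t] in [B]:
    otherwise both reach [B] without meeting [x], and [B] minus [x] stays
    connected. *)
Lemma essential_gate B s t x : is_connected G -> S `<=` vertices G ->
  block G B -> S s -> S t -> B x -> essential s t x -> gates G B S x.
Proof.
move=> [_ Gconn] SG bB Ss St Bx [xs|xt|sep].
- by exists s => //; rewrite xs in Bx *; apply: gate_refl.
- by exists t => //; rewrite xt in Bx *; apply: gate_refl.
have gate_ex a : S a -> exists c, gate G B a c.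
  move=> /SG Ga; apply: (gate_exists Bx).
  by have [p [_ pP px _]] := Gconn a x Ga (block_sub bB Bx); exists p.
have [[c sc] [c' tc']] := (gate_ex s Ss, gate_ex t St).
have [xc|/eqP xNc] := eqVneq x c; first by exists s; rewrite // xc.
have [xc'|/eqP xNc'] := eqVneq x c'; first by exists t; rewrite // xc'.
case: sep.
have avoid a b : gate G B a b -> x <> b -> conn (within G (~` [set x])) a b.
  move=> [_ ab] xNb; apply: conn_within_sub ab => z /= zb zx.
  by apply: xNb; rewrite -zx; apply: zb; rewrite zx.
apply: conn_trans (avoid s c sc xNc) _.
apply: conn_trans (conn_within_sym (avoid t c' tc' xNc')).
by case: sc tc' => Bc _ [Bc' _]; apply: (block_unseparated bB).
Qed.

(** Walk along a path from [s] to [t] and split it at the vertices that separate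
    [s] from [t].  In the induction, [x] and [y] are essential vertices and [p]
    is the part of the path between them; the last hypothesis says that the rest
    of the path avoids the inside of [p].  It makes any vertex that separates
    [x] from [y] separate [s] from [t] too, so that the part can be split there;
    if there is none, [x] and [y] are gates in a common block. *)
Lemma conn_essential (e : rel V) s t : is_connected G -> S `<=` vertices G ->
  S s -> S t ->
  (forall B x y, block G B -> gates G B S x -> gates G B S y -> conn e x y) ->
  conn e s t.
Proof.
move=> Gconn SG Ss St He.
have [q [_ qP qt q_uniq]] := Gconn.2 s t (SG s Ss) (SG t St).
have avoid x p y c : path (adj G) x p -> last x p = y -> c \notin x :: p ->
    conn (within G (~` [set c])) x y.
  move=> pP py cNp; exists p => //; apply: path_withinI => // z zp zc.
  by move: cNp; rewrite -zc zp.
suff Hind n x y p : (size p < n)%N -> vertices G x -> vertices G y ->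
    essential s t x -> essential s t y ->
    path (adj G) x p -> last x p = y -> uniq (x :: p) ->
    (forall c, c \in p -> c <> y -> conn (within G (~` [set c])) s x /\
                                    conn (within G (~` [set c])) y t) ->
    conn e x y.
  apply: (Hind (size q).+1 s t q) => //; try exact: SG.
  - exact: Or31.
  - exact: Or32.
  - by move=> c _ _; split; apply: conn_refl.
elim: n x y p => // n IHn x y p pn Gx Gy sx sy pP py p_uniq Hp.
have [<-|/eqP xNy] := eqVneq x y; first exact: conn_refl.
have [xy|] := pselect (unseparated G x y).
  have [B bB [Bx By]] := block_exists Gx Gy xNy xy.
  by apply: (He B) => //; apply: (essential_gate (s := s) (t := t)).
move=> /existsNP[c /not_implyP[cNx /not_implyP[cNy xcy]]].
have cp : c \in p.
  apply: contrapT => cNp; apply: xcy; apply: avoid pP py _.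
  by rewrite inE negb_or; apply/andP; split; [apply/eqP|apply/negP].
have [scx ycy] := Hp c cp cNy.
have sc : essential s t c.
  apply: Or33 => st; apply: xcy.
  by apply: conn_trans (conn_within_sym scx) (conn_trans st (conn_within_sym ycy)).
case/path.splitP: cp pn pP py p_uniq Hp => p1 p2.
rewrite size_cat size_rcons cat_path last_cat last_rcons ltnS => pn /andP[p1P p2P] py.
rewrite -cat_cons cat_uniq => /and3P[p1_uniq /hasPn disj p2_uniq] Hp.
have p2y : y \in p2.
  by have := mem_last c p2; rewrite py inE => /predU1P[/esym|].
have Gc : vertices G c by have := path_vertices Gx p1P; rewrite last_rcons.
have p2_gt0 : (0 < size p2)%N by case: (p2) p2y.
apply: (@conn_trans _ _ c).
  apply: (IHn x c (rcons p1 c)) => //.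
  - by rewrite size_rcons; apply: leq_trans pn; rewrite -[X in (X <= _)%N]addn1 leq_add2l.
  - by rewrite last_rcons.
  - move=> d dp dNc; have [||sdx ydt] := Hp d.
    + by rewrite mem_cat dp.
    + by move=> dy; move: (disj y p2y); rewrite -dy inE dp orbT.
    split=> //; apply: conn_trans ydt; apply: avoid p2P py _.
    rewrite inE negb_or; apply/andP; split; first exact/eqP.
    by apply/negP => /disj; rewrite inE dp orbT.
apply: (IHn c y p2) => //.
- by apply: leq_trans pn; rewrite addSn ltnS leq_addl.
- rewrite /= p2_uniq andbT; apply/negP => /disj.
  by rewrite inE mem_rcons inE eqxx orbT.
- move=> d dp dNy; have [||sdx ydt] := Hp d => //.
    by rewrite mem_cat dp orbT.
  split=> //; apply: conn_trans sdx _; apply: (avoid _ _ _ _ p1P).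
    by rewrite last_rcons.
  exact: disj.
Qed.

End Linking.

Theorem theorem4p5 (kriesell : kriesell_conjecture)
    (k : nat) (k_gt0 : (0 < k)%N)
    (V : eqType) (G : graph V) (S : set V)
    (G_connected : is_connected G)
    (G_separable : finitely_edge_separable G)
    (G_rayless : rayless G)
    (S_sub : S `<=` vertices G)
    (S_edge_connected : edge_connected_in G (2 * k)%N S) :
  has_disjoint_steiner_trees G k S.
Proof.
have /choice[T TP] : forall B, exists T : 'I_k -> graph V, block G B ->
    (forall i, steiner_tree (induced G B) (gates G B S) (T i)) /\
    trivIset [set: 'I_k] (fun i => edges (T i)).
  move=> B; have [bB|nbB] := pselect (block G B); last by exists (fun=> G).
  have [||||T TP] := @kriesell k V (induced G B) (gates G B S) k_gt0.
  - exact: (block_finite G_separable G_rayless bB G_connected).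
  - exact: induced_block_connected.
  - by move=> c [s _ []].
  - exact: gates_edge_connected.
  by exists T.
(* the union of the i-th trees of all blocks *)
pose U i := [rel x y | `[< exists2 B, block G B & edges (T B i) (x, y) >]].
have U_sym i : symmetric (U i).
  by move=> x y; apply/asboolP/asboolP => -[B bB /edges_sym xy]; exists B.
have T_induced B i x y : block G B -> edges (T B i) (x, y) ->
    [/\ edges G (x, y), B x & B y].
  move=> bB xy; have [[_ sub] _ _] := (TP B bB).1 i.
  by have [] := sub (x, y) xy.
have U_G i : subrel (U i) (adj G).
  by move=> x y /asboolP[B bB /(T_induced _ _ _ _ bB)[xy _ _]]; apply/adjP.
have U_disj i j x y : U i x y -> U j x y -> i = j.
  move=> /asboolP[B bB xy] /asboolP[B' bB' xy'].
  have [Gxy Bx By] := T_induced _ _ _ _ bB xy.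
  have [_ B'x B'y] := T_induced _ _ _ _ bB' xy'.
  have xNy : x <> y by move=> xEy; move: Gxy; rewrite xEy => /edges_irrefl.
  have BB' := block_eq bB bB' xNy Bx By B'x B'y; subst B'.
  by apply: (TP B bB).2 => //; exists (x, y).
have U_conn i s t : S s -> S t -> conn (U i) s t.
  move=> Ss St; apply: (conn_essential G_connected S_sub Ss St) => B x y bB Bx By.
  have [_ [[_ Tconn] _] TS] := (TP B bB).1 i.
  have [p [_ pP py _]] := Tconn x y (TS _ Bx) (TS _ By).
  exists p => //; apply: sub_path pP => a b /adjP ab.
  by apply/asboolP; exists B.
have [s Gs Ss] : exists2 s, vertices G s & forall i, S `<=` conn (U i) s.
  have [[s Ss]|nS] := pselect (S !=set0).
    by exists s; [apply: S_sub|move=> i t; apply: U_conn].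
  have [[s Gs] _] := G_connected.
  by exists s => // i t St; case: nS; exists t.
have /choice[W WP] : forall i, exists W, steiner_tree G S W /\
    forall x y, edges W (x, y) -> U i x y.
  move=> i; have [W [WG Wtree Ws WU]] := spanning_tree (U_sym i) (U_G i) Gs.
  by exists W; split=> //; split=> // t /(Ss i) /Ws.
exists W; split=> [i|i j _ _ [[x y] [xi xj]]]; first by case: (WP i).
exact: U_disj ((WP i).2 x y xi) ((WP j).2 x y xj).
Qed.
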